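(* (The Tangent Rule) Let $p\ge 0$ be an integer and suppose that $W_p(\alpha,\beta)$ is a hyperbolic cone-manifold. Denote by $\gamma_\alpha$ and $\gamma_\beta$ the complex lengths of the singular geodesics of $W_p(\alpha,\beta)$ with cone angles $\alpha$ and $\beta$ respectively. Then $$\frac{\tanh\frac{\gamma_\alpha}{4}}{\tanh\frac{\gamma_\beta}{4}}=\frac{\tan\frac{\alpha}{2}}{\tan\frac{\beta}{2}}.$$
   Context: A 3-dimensional hyperbolic cone-manifold is a Riemannian 3-manifold of constant sectional curvature $-1$ with cone-type singularities along simple closed geodesics, each singular component having a cone angle. For an integer $p\ge 0$, the twist link $W_p$ is the two-component two-bridge link in $S^3$ with slope $(4p+4)/(2p+1)$. $W_p(\alpha,\beta)$ is the cone-manifold with underlying space $S^3$ and singular set $W_p=\Sigma^1\cup\Sigma^2$, with cone angle $\alpha$ along $\Sigma^1$ and $\beta$ along $\Sigma^2$, where $0<\alpha,\beta\le\pi$. The fundamental group of $S^3\setminus W_p$ is $\Phi_p=\langle s,t\mid s l_s=l_s s\rangle=\langle s,t\mid t l_t=l_t t\rangle$, where $s,t$ are meridians of $\Sigma^1,\Sigma^2$ and $l_s,l_t$ the corresponding longitudes. With $[x,y]=xyx^{-1}y^{-1}$, $$l_s=[s,t]^{\frac{p+1}{2}}[s,t^{-1}]^{\frac{p+1}{2}}\ (p\text{ odd}),\qquad l_s=s^{-1}[t,s]^{\frac p2}\,tst\,[s^{-1},t^{-1}]^{\frac p2}\ (p\text{ even}),$$ and $l_t$ is obtained by exchanging $s$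 and $t$. If $W_p(\alpha,\beta)$ is hyperbolic, its holonomy homomorphism lifts to $h=h_{\alpha,\beta}:\Phi_p\to SL(2,\mathbf C)$, where $S=h(s)$ and $T=h(t)$ satisfy $\mathrm{tr}(S)=2\cos\frac\alpha2$, $\mathrm{tr}(T)=2\cos\frac\beta2$. Put $L_S=h(l_s)$, $L_T=h(l_t)$; these are loxodromic. The displacement of an isometry of $\mathbf H^3$ translating by $r$ along its axis and rotating by $\varphi$ about it is the complex number $r+i\varphi$. The complex length $\gamma_\alpha=r_\alpha+i\varphi_\alpha$ (resp. $\gamma_\beta=r_\beta+i\varphi_\beta$) of the singular component with cone angle $\alpha$ (resp. $\beta$) is the displacement of $L_S$ (resp. $L_T$), normalized so that $r_\alpha>0$ and $\cosh\frac{\gamma_\alpha}{2}=-\frac12\mathrm{tr}(L_S)$ (resp. $r_\beta>0$ and $\cosh\frac{\gamma_\beta}{2}=-\frac12\mathrm{tr}(L_T)$). Thus the eigenvalue of $L_S$ of modulus $>1$ is $-e^{\gamma_\alpha/2}$, and similarly for $L_T$. *)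

(* Defs.v *)
From HB Require Import structures.
From mathcomp Require Import all_boot all_order all_algebra.
From mathcomp Require Import all_classical all_reals all_analysis.
From mathcomp Require Import complex.

Set Implicit Arguments.
Unset Strict Implicit.
Unset Printing Implicit Defensive.

Import Order.TTheory GRing.Theory Num.Theory.
Import numFieldNormedType.Exports.

Local Open Scope classical_set_scope.
Local Open Scope ring_scope.

(** * Hyperbolic functions *)

Definition cosh (R : realType) (x : R) : R := (expR x + expR (- x)) / 2.
Definition sinh (R : realType) (x : R) : R := (expR x - expR (- x)) / 2.

Definition cexp (R : realType) (z : R[i]) : R[i] :=
  Complex (expR (complex.Re z) * cos (complex.Im z))
          (expR (complex.Re z) * sin (complex.Im z)).
Definition ccosh (R : realType) (z : R[i]) : R[i] := (cexp z + cexp (- z)) / 2.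
Definition csinh (R : realType) (z : R[i]) : R[i] := (cexp z - cexp (- z)) / 2.
Definition ctanh (R : realType) (z : R[i]) : R[i] := csinh z / ccosh z.

(** * Hyperbolic 3-space
    H^3 is the set of positive definite Hermitian matrices of determinant 1, on
    which SL(2,C) acts by X |-> A X A^*; this realises PSL(2,C) as the group of
    orientation-preserving isometries. *)

Definition ctrmx (R : realType) (A : 'M[R[i]]_2) : 'M[R[i]]_2 :=
  map_mx (@conjc R) A^T.

Definition H3 (R : realType) : set 'M[R[i]]_2 :=
  [set X | [/\ ctrmx X = X, \det X = 1 & 0 < complex.Re (\tr X)]].

Definition act (R : realType) (A X : 'M[R[i]]_2) : 'M[R[i]]_2 :=
  A *m X *m ctrmx A.

(** The hyperbolic cosine of the distance in H^3. *)
Definition H3_cosh (R : realType) (X Y : 'M[R[i]]_2) : R :=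
  complex.Re (\tr (X *m \adj Y)) / 2.

(** The point at distance [rho] from the axis joining the boundary points 0 and
    oo, at angle [theta] around it and height [h] along it.  In the upper
    half-space it is (z, t) = e^h (tanh rho * e^(i theta), 1 / cosh rho). *)
Definition fermi (R : realType) (rho theta h : R) : 'M[R[i]]_2 :=
  \matrix_(i < 2, j < 2)
    if i == 0
    then if j == 0 then Complex (expR h * cosh rho) 0
         else Complex (sinh rho * cos theta) (sinh rho * sin theta)
    else if j == 0
         then Complex (sinh rho * cos theta) (- (sinh rho * sin theta))
         else Complex (expR (- h) * cosh rho) 0.

(** [gamma] is r + i phi when L translates by r along an oriented line and
    rotates by phi about it.  The line is the image under [g] of the axis of
    [fermi]. *)
Definition is_displacement (R : realType) (L : 'M[R[i]]_2) (gamma : R[i]) : Prop :=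
  exists2 g : 'M[R[i]]_2, \det g = 1 &
    forall rho theta h : R, 0 <= rho ->
      act L (act g (fermi rho theta h)) =
      act g (fermi rho (theta + complex.Im gamma) (h + complex.Re gamma)).

(** The trace condition removes the ambiguity of Im gamma modulo 2 pi, leaving
    it defined modulo 4 pi. *)
Definition is_complex_length (R : realType) (L : 'M[R[i]]_2) (gamma : R[i]) : Prop :=
  [/\ is_displacement L gamma,
      0 < complex.Re gamma &
      ccosh (gamma / 2) = - (\tr L / 2)].

(** * The twist link in the 3-sphere *)

Definition S3 (R : realType) : set 'rV[R]_4 :=
  [set x | \sum_(j < 4) x 0 j ^+ 2 = 1].

(** For fixed c, (x, y) |-> link_point x y c is injective modulo the group
    generated by the half-turns of the plane about the integer points.  The
    quotient is a sphere with four marked points (the "pillowcase"), and c = 0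
    gives the equatorial 2-sphere of S^3: the surface
    Z^2 = (1 - X^2) (1 - Y^2), |X| <= 1, |Y| <= 1, traced by the first three
    entries before normalisation, is star-shaped about the origin.  The sign of
    c tells the side of the equator on which the point lies. *)
Definition link_point (R : realType) (x y c : R) : 'rV[R]_4 :=
  let v : 'rV[R]_4 :=
    \row_j nth 0 [:: cos (pi * x); cos (pi * y); sin (pi * x) * sin (pi * y); c] j in
  (Num.sqrt (\sum_(j < 4) v 0 j ^+ 2))^-1 *: v.

(** The two components (i = 0 and i = 1) of the two-bridge link of slope a / b,
    for coprime a and b with a even.  The rational arc in direction (a, b) and
    the one in direction (0, 1), both issuing from the marked point (i, 0) and
    both ending at the marked point (i, 1) = (i + a, b), have their interiors
    pushed to opposite sides of the equatorial sphere.  The two directions span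
    a parallelogram of area a in the lattice, and the double branched cover is
    the lens space L(a, b).  Reversing the orientation of S^3 exchanges the
    slopes a / b and - a / b; nothing below depends on that orientation. *)
Definition two_bridge_component (R : realType) (a b i : nat) : set 'rV[R]_4 :=
  [set link_point (i%:R + a%:R * u) (b%:R * u) (- (u * (1 - u))) | u in `[0, 1]]
  `|` [set link_point i%:R u (u * (1 - u)) | u in `[0, 1]].

Definition Sigma1 (R : realType) (p : nat) : set 'rV[R]_4 :=
  @two_bridge_component R (4 * p + 4) (2 * p + 1) 0.
Definition Sigma2 (R : realType) (p : nat) : set 'rV[R]_4 :=
  @two_bridge_component R (4 * p + 4) (2 * p + 1) 1.

Definition link_complement (R : realType) (p : nat) : set 'rV[R]_4 :=
  @S3 R `\` (@Sigma1 R p `|` @Sigma2 R p).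

(** * Hyperbolic cone-manifolds *)

(** The distance from x to 0 on the circle of length omega. *)
Definition circle_dist (R : realType) (omega x : R) : R :=
  inf [set `|x + k%:~R * omega| | k in [set: int]].

(** The hyperbolic cosine of the distance between two points, given in
    cylindrical coordinates (rho, theta, h) with theta taken modulo omega, of
    the model with metric
    d rho^2 + sinh^2 rho d theta^2 + cosh^2 rho d h^2,
    i.e. of the neighbourhood of an axis with cone angle omega <= 2 pi.  For
    omega = 2 pi the model is H^3. *)
Definition cone_cosh (R : realType) (omega : R) (u v : R * R * R) : R :=
  let: (rho, theta, h) := u in
  let: (rho', theta', h') := v in
  cosh rho * cosh rho' * cosh (h - h')
  - sinh rho * sinh rho' * cos (circle_dist omega (theta - theta')).

Definition cone_ball (R : realType) (omega eps : R) : set (R * R * R) :=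
  [set u | 0 <= u.1.1 /\ cone_cosh omega (0, 0, 0) u < cosh eps].

(** F parametrises isometrically the metric ball of centre x and radius eps by
    the ball of radius eps about a point of the axis of the model. *)
Definition is_cone_chart (R : realType) (d : 'rV[R]_4 -> 'rV[R]_4 -> R)
    (omega : R) (x : 'rV[R]_4) (eps : R) (F : R * R * R -> 'rV[R]_4) : Prop :=
  [/\ 0 < eps,
      F (0, 0, 0) = x,
      (forall u, cone_ball omega eps u -> S3 (F u)),
      (forall u v, cone_ball omega eps u -> cone_ball omega eps v ->
         cosh (d (F u) (F v)) = cone_cosh omega u v) &
      (forall y, S3 y -> d x y < eps ->
         exists2 u, cone_ball omega eps u & F u = y)].

Definition cone_angle (R : realType) (p : nat) (alpha beta : R) (x : 'rV[R]_4) : R :=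
  if x \in Sigma1 p then alpha else if x \in Sigma2 p then beta else 2 * pi.

(** d is a distance on S^3 inducing its topology, for which S^3 is locally
    isometric to H^3 off the link, and to the model of cone angle alpha
    (resp. beta), with centre on the axis, at the points of the first
    (resp. second) component. *)
Definition is_hyperbolic_twist_cone_manifold (R : realType) (p : nat)
    (alpha beta : R) (d : 'rV[R]_4 -> 'rV[R]_4 -> R) : Prop :=
  [/\ (forall x y, S3 x -> S3 y -> [/\ 0 <= d x y, d x y = d y x & (d x y = 0 <-> x = y)]),
      (forall x y z, S3 x -> S3 y -> S3 z -> d x z <= d x y + d y z),
      (forall x e, S3 x -> 0 < e ->
         exists2 delta, 0 < delta & forall y, S3 y -> `|x - y| < delta -> d x y < e),
      (forall x e, S3 x -> 0 < e ->
         exists2 delta, 0 < delta & forall y, S3 y -> d x y < delta -> `|x - y| < e) &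
      (forall x, S3 x ->
         exists eps F, is_cone_chart d (cone_angle p alpha beta x) x eps F)].

(** * Loops and homotopies *)

Definition is_loop (R : realType) (N : set 'rV[R]_4) (x0 : 'rV[R]_4)
    (c : R -> 'rV[R]_4) : Prop :=
  [/\ {within `[0, 1], continuous c},
      (forall u, u \in `[0, 1] -> N (c u)), c 0 = x0 & c 1 = x0].

Definition is_homotopy (R : realType) (N : set 'rV[R]_4)
    (H : R * R -> 'rV[R]_4) (c c' : R -> 'rV[R]_4) : Prop :=
  [/\ {within `[0, 1] `*` `[0, 1], continuous H},
      (forall u v, u \in `[0, 1] -> v \in `[0, 1] -> N (H (u, v))),
      (forall u, u \in `[0, 1] -> H (u, 0) = c u) &
      (forall u, u \in `[0, 1] -> H (u, 1) = c' u)].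

Definition homotopic (R : realType) (N : set 'rV[R]_4) (x0 : 'rV[R]_4)
    (c c' : R -> 'rV[R]_4) : Prop :=
  exists2 H, is_homotopy N H c c' &
    forall v, v \in `[0, 1] -> H (0, v) = x0 /\ H (1, v) = x0.

Definition freely_homotopic (R : realType) (N : set 'rV[R]_4)
    (c c' : R -> 'rV[R]_4) : Prop :=
  exists2 H, is_homotopy N H c c' &
    forall v, v \in `[0, 1] -> H (0, v) = H (1, v).

Definition concat (R : realType) (c c' : R -> 'rV[R]_4) : R -> 'rV[R]_4 :=
  fun u => if u <= 1 / 2 then c (2 * u) else c' (2 * u - 1).

(** * The group Phi_p *)

Inductive word : Type :=
  | Wone
  | Ws
  | Wt
  | Winv of word
  | Wmul of word & word.

Fixpoint Wpow (w : word) (n : nat) : word :=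
  if n is m.+1 then Wmul w (Wpow w m) else Wone.

Definition Wcomm (x y : word) : word :=
  Wmul (Wmul (Wmul x y) (Winv x)) (Winv y).

(** [longitude p Ws Wt] is l_s, and [longitude p Wt Ws] is l_t. *)
Definition longitude (p : nat) (s t : word) : word :=
  if odd p then
    Wmul (Wpow (Wcomm s t) p.+1./2) (Wpow (Wcomm s (Winv t)) p.+1./2)
  else
    Wmul (Wmul (Wmul (Winv s) (Wpow (Wcomm t s) p./2)) (Wmul (Wmul t s) t))
         (Wpow (Wcomm (Winv s) (Winv t)) p./2).

(** Equality of the elements of Phi_p represented by two words.  Each of the
    last two relations alone presents the group: the two relators are cyclically
    conjugate up to inversion. *)
Inductive Phi_eq (p : nat) : word -> word -> Prop :=
  | Phi_refl w : Phi_eq p w w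
  | Phi_sym w w' : Phi_eq p w w' -> Phi_eq p w' w
  | Phi_trans w w' w'' : Phi_eq p w w' -> Phi_eq p w' w'' -> Phi_eq p w w''
  | Phi_cmul w w' v v' :
      Phi_eq p w w' -> Phi_eq p v v' -> Phi_eq p (Wmul w v) (Wmul w' v')
  | Phi_cinv w w' : Phi_eq p w w' -> Phi_eq p (Winv w) (Winv w')
  | Phi_assoc u v w : Phi_eq p (Wmul u (Wmul v w)) (Wmul (Wmul u v) w)
  | Phi_mul1 w : Phi_eq p (Wmul Wone w) w
  | Phi_mulV w : Phi_eq p (Wmul (Winv w) w) Wone
  | Phi_rel_s :
      Phi_eq p (Wmul Ws (longitude p Ws Wt)) (Wmul (longitude p Ws Wt) Ws)
  | Phi_rel_t :
      Phi_eq p (Wmul Wt (longitude p Wt Ws)) (Wmul (longitude p Wt Ws) Wt).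

(** The determinant and product conditions force the values at [Wone] and at
    [Winv w]. *)
Definition is_SL2_rep (R : realType) (p : nat) (h : word -> 'M[R[i]]_2) : Prop :=
  [/\ (forall w, \det (h w) = 1),
      (forall w w', h (Wmul w w') = h w *m h w') &
      (forall w w', Phi_eq p w w' -> h w = h w')].

Fixpoint word_loop (R : realType) (x0 : 'rV[R]_4) (sigma tau : R -> 'rV[R]_4)
    (w : word) : R -> 'rV[R]_4 :=
  match w with
  | Wone => fun=> x0
  | Ws => sigma
  | Wt => tau
  | Winv w' => fun u => word_loop x0 sigma tau w' (1 - u)
  | Wmul w' w'' => concat (word_loop x0 sigma tau w') (word_loop x0 sigma tau w'')
  end.

(** A meridian is freely homotopic, off the link, to a small circle around a
    point of the component in question. *)
Definition is_meridian (R : realType) (d : 'rV[R]_4 -> 'rV[R]_4 -> R)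
    (N Sigma : set 'rV[R]_4) (omega : R) (c : R -> 'rV[R]_4) : Prop :=
  exists x eps F r,
    [/\ Sigma x, is_cone_chart d omega x eps F, 0 < r < eps &
        freely_homotopic N c (fun u => F (r, u * omega, 0))].

(** s |-> [sigma], t |-> [tau] defines an isomorphism from Phi_p onto the
    fundamental group of the link complement, and sigma, tau are meridians of
    the two components. *)
Definition is_meridian_marking (R : realType) (p : nat) (alpha beta : R)
    (d : 'rV[R]_4 -> 'rV[R]_4 -> R) (x0 : 'rV[R]_4)
    (sigma tau : R -> 'rV[R]_4) : Prop :=
  let N := link_complement p in
  [/\ is_loop N x0 sigma /\ is_loop N x0 tau,
      is_meridian d N (Sigma1 p) alpha sigma,
      is_meridian d N (Sigma2 p) beta tau,
      (forall w w', homotopic N x0 (word_loop x0 sigma tau w) (word_loop x0 sigma tau w')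
                    <-> Phi_eq p w w') &
      (forall c, is_loop N x0 c -> exists w, homotopic N x0 c (word_loop x0 sigma tau w))].

(** * Holonomy *)

Definition is_local_isometry (R : realType) (d : 'rV[R]_4 -> 'rV[R]_4 -> R)
    (x : 'rV[R]_4) (f : 'rV[R]_4 -> 'M[R[i]]_2) : Prop :=
  exists2 delta, 0 < delta & forall y z, S3 y -> S3 z -> d x y < delta -> d x z < delta ->
    H3 (f y) /\ H3_cosh (f y) (f z) = cosh (d y z).

Definition same_germ (R : realType) (d : 'rV[R]_4 -> 'rV[R]_4 -> R)
    (x : 'rV[R]_4) (f g : 'rV[R]_4 -> 'M[R[i]]_2) : Prop :=
  exists2 delta, 0 < delta & forall y, S3 y -> d x y < delta -> f y = g y.

(** Continuation of germs of local isometries into H^3 along the path c. *)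
Definition is_continuation (R : realType) (d : 'rV[R]_4 -> 'rV[R]_4 -> R)
    (c : R -> 'rV[R]_4) (f : R -> 'rV[R]_4 -> 'M[R[i]]_2) : Prop :=
  forall u, u \in `[0, 1] ->
    is_local_isometry d (c u) (f u) /\
    exists2 delta, 0 < delta &
      forall v, v \in `[0, 1] -> `|v - u| < delta -> same_germ d (c v) (f v) (f u).

(** Continuing the germ [dev] of the developing map along the loop c yields
    A . dev.  With this convention the loop "c, then c'" yields A A' . dev, so
    that holonomy is a homomorphism. *)
Definition is_holonomy (R : realType) (d : 'rV[R]_4 -> 'rV[R]_4 -> R)
    (dev : 'rV[R]_4 -> 'M[R[i]]_2) (c : R -> 'rV[R]_4) (A : 'M[R[i]]_2) : Prop :=
  exists f, [/\ is_continuation d c f,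
                same_germ d (c 0) (f 0) dev &
                same_germ d (c 1) (f 1) (fun y => act A (dev y))].

(** h : Phi_p -> SL(2,C) lifts the holonomy homomorphism of the cone-manifold,
    with the normalised traces of the images of the meridians. *)
Definition is_holonomy_lift (R : realType) (p : nat) (alpha beta : R)
    (d : 'rV[R]_4 -> 'rV[R]_4 -> R) (h : word -> 'M[R[i]]_2) : Prop :=
  exists x0 sigma tau dev,
    [/\ is_meridian_marking p alpha beta d x0 sigma tau,
        is_SL2_rep p h,
        (forall w, is_holonomy d dev (word_loop x0 sigma tau w) (h w)),
        \tr (h Ws) = Complex (2 * cos (alpha / 2)) 0 &
        \tr (h Wt) = Complex (2 * cos (beta / 2)) 0].

(* Main.v *)
Require Import Defs.
From mathcomp Require Import all_boot all_order all_algebra.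
From mathcomp Require Import all_classical all_reals all_analysis.
From mathcomp Require Import complex.
From mathcomp Require Import ring lra.

Set Implicit Arguments.
Unset Strict Implicit.
Unset Printing Implicit Defensive.

Import Order.TTheory GRing.Theory Num.Theory.

Local Open Scope ring_scope.

(** The rule is an identity between traces.  Put x = tr S, y = tr T, z = tr ST,
    K = [S, T], k = tr K.  Regrouping the words gives
      L_S = E T^-1 E^-1 T,  E = [S, T]^n          (p odd, n = (p + 1) / 2),
      L_S = E T E^-1 T,     E = S^-1 [T, S]^n     (p even, n = p / 2),
    and L_T by exchanging S and T.  By Cayley-Hamilton, [S, T]^n = u + v [S, T]
    and [T, S]^n = u + v [T, S] with the same u, v, so the dependence on p
    disappears: tr L_S, tr L_T and the relation S L_S = L_S S become polynomial in
    x, y, z, u, v.  In both parities they take the form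
      tr L_S = 2 + m (k + 2 - y^2),   tr L_T = 2 + m (k + 2 - x^2),
      (2z - xy)^2 (4 + (k + 2) m) = x^2 y^2 m (k - 2),
    with m = v^2 (k - 2) for p odd and m = - (u + v (k - 1))^2 for p even, as
    soon as L_S is loxodromic.  These three equations imply
      (tr L_S + 2) / (tr L_S - 2) * cot^2 (alpha / 2)
        = (tr L_T + 2) / (tr L_T - 2) * cot^2 (beta / 2),
    which is the square of the rule, since
    tanh^2 (gamma / 4) = (tr L + 2) / (tr L - 2).  The sign is recovered from
    Re (tanh (gamma / 4)) > 0. *)

(** * Traces of 2 x 2 matrices *)

Lemma mxtrace2 (R : pzRingType) (A : 'M[R]_2) : \tr A = A 0 0 + A 1 1.
Proof. by rewrite /mxtrace big_ord_recl big_ord1; congr (_ + A _ _); apply/val_inj. Qed.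

Lemma mul_mx2 (R : pzRingType) (A B : 'M[R]_2) i j :
  (A * B) i j = A i 0 * B 0 j + A i 1 * B 1 j.
Proof.
by rewrite mxE big_ord_recl big_ord1; congr (_ + A _ _ * B _ _); apply/val_inj.
Qed.

Lemma det_mx2 (R : comPzRingType) (A : 'M[R]_2) :
  \det A = A 0 0 * A 1 1 - A 0 1 * A 1 0.
Proof.
have e1 : lift 0 0 = 1 :> 'I_2 by apply/val_inj.
have e0 : lift 1 0 = 0 :> 'I_2 by apply/val_inj.
rewrite (expand_det_row _ 0) big_ord_recl big_ord1 /cofactor !det_mx11 !mxE e1 e0 /=.
by rewrite expr0 expr1 mul1r mulN1r mulrN.
Qed.

Ltac mx2_ring := rewrite ?mxtrace2 ?det_mx2 ?(mul_mx2, mxE, mxtrace2) /=; ring.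

(* In the lemmas [_hom], [\tr A - A] and determinants stand for the inverses of
   SL(2), so that the statements are polynomial identities in the entries. *)
Lemma tr_inv_sandwich_hom (R : comNzRingType) (E T : 'M[R]_2) :
  \tr (E * T * ((\tr E)%:M - E) * T) =
  2 * \det E * \det T - \tr E ^+ 2 * \det T - \tr (E * T) ^+ 2
  + \tr E * \tr (E * T) * \tr T.
Proof. mx2_ring. Qed.

Lemma tr_sandwich_commutator_hom (R : comNzRingType) (S E T : 'M[R]_2) :
  let M := E * T * ((\tr E)%:M - E) * T in
  \tr (S * M * T) - \tr (M * S * T) =
  \tr (S * E * T) * (\tr E * \tr T ^+ 2 - \tr (E * T) * \tr T
                     - 2 * \tr E * \det T)
  + \tr (S * E) * (2 * \tr (E * T) - \tr E * \tr T) * \det T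
  + \tr (S * T) * (\tr E ^+ 2 * \det T + \tr (E * T) ^+ 2
                   - \tr E * \tr (E * T) * \tr T).
Proof. move=> M; rewrite /M; mx2_ring. Qed.

Lemma tr_commutator_hom (R : comNzRingType) (S T : 'M[R]_2) :
  \tr (S * T * ((\tr S)%:M - S) * ((\tr T)%:M - T)) =
  \tr S ^+ 2 * \det T + \tr T ^+ 2 * \det S + \tr (S * T) ^+ 2
  - \tr S * \tr T * \tr (S * T) - 2 * \det S * \det T.
Proof. mx2_ring. Qed.

Lemma mx2P (T : Type) (A B : 'M[T]_2) :
  A 0 0 = B 0 0 -> A 0 1 = B 0 1 -> A 1 0 = B 1 0 -> A 1 1 = B 1 1 -> A = B.
Proof.
have ord2 (i : 'I_2) : i = 0 \/ i = 1.
  by case: i => [[|[|//]] ?]; [left | right]; apply/val_inj.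
move=> ? ? ? ?; apply/matrixP => i j.
by case: (ord2 i) => ->; case: (ord2 j) => ->.
Qed.

Lemma cayley_hamilton2 (R : comNzRingType) (A : 'M[R]_2) :
  A * A = \tr A *: A - (\det A)%:M.
Proof. by apply: mx2P; mx2_ring. Qed.

(** Reduces a consequence of one equation [p = q] to a [ring] goal; the cofactor [c] is supplied
    explicitly at each use. *)
Lemma eq_of_multiple (R : pzRingType) (a b c p q : R) :
  p = q -> a - b = c * (p - q) -> a = b.
Proof. by move=> -> /eqP; rewrite subrr mulr0 subr_eq0 => /eqP. Qed.

(** * Inverses, determinants and traces in SL(2) over a field *)

Section SL2.
Variable F : fieldType.
Implicit Types A B S T E : 'M[F]_2.

Lemma SL2_unit A : \det A = 1 -> A \is a GRing.unit.
Proof. by move=> dA; rewrite [_ \is a _]unitmxE dA unitr1. Qed.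

Lemma SL2_inv A : \det A = 1 -> A^-1 = (\tr A)%:M - A.
Proof.
move=> dA; apply: (mulrI (SL2_unit dA)); rewrite divrr ?SL2_unit //.
rewrite mulrBr cayley_hamilton2 dA opprB addrCA (_ : A * _ = \tr A *: A) ?subrr ?addr0 //.
exact: mul_mx_scalar.
Qed.

Lemma mxtr_mulC A B : \tr (A * B) = \tr (B * A).
Proof. exact: mxtrace_mulC. Qed.

Lemma det_mulr A B : \det (A * B) = \det A * \det B.
Proof. exact: det_mulmx. Qed.

Lemma SL2_tr_inv A : \det A = 1 -> \tr A^-1 = \tr A.
Proof.
by move=> dA; rewrite SL2_inv // mxtraceD mxtrace_scalar linearN /= mulr2n addrK.
Qed.

Lemma SL2_det_inv A : \det A = 1 -> \det A^-1 = 1.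
Proof. by move=> dA; rewrite [A^-1]/(invmx A) det_inv dA invr1. Qed.

Lemma SL2_det_exp A n : \det A = 1 -> \det (A ^+ n) = 1.
Proof.
by move=> dA; elim: n => [|n IH]; rewrite ?expr0 ?det1 // exprS det_mulr dA IH mulr1.
Qed.

(** By Cayley-Hamilton, [A + A^-1] is the scalar matrix [\tr A]. *)
Lemma SL2_tr_mul A B : \det A = 1 -> \tr (A * B) = \tr A * \tr B - \tr (A^-1 * B).
Proof.
move=> dA; rewrite (SL2_inv dA) mulrBl linearB /= (_ : _%:M * B = \tr A *: B).
  by rewrite linearZ /= subKr.
exact: mul_scalar_mx.
Qed.
End SL2.

Definition commutator (R : unitRingType) (a b : R) := a * b * a^-1 * b^-1.

(** * Traces of short words in [S], [T] and their commutator *)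

Section Traces.
Variable F : fieldType.
Variables S T : 'M[F]_2.
Hypotheses (dS : \det S = 1) (dT : \det T = 1).

Lemma det_commutator : \det (commutator S T) = 1.
Proof. by rewrite !det_mulr !SL2_det_inv // dS dT !mulr1. Qed.

Lemma tr_commutator : \tr (commutator S T) =
  \tr S ^+ 2 + \tr T ^+ 2 + \tr (S * T) ^+ 2 - \tr S * \tr T * \tr (S * T) - 2.
Proof. by rewrite /commutator !SL2_inv // tr_commutator_hom dS dT !mulr1. Qed.

Local Notation k := (\tr (commutator S T)).
Let uS := SL2_unit dS.
Let uT := SL2_unit dT.

Lemma tr_commutator_mulr : \tr (commutator S T * T) = \tr T.
Proof. by rewrite /commutator divrK // mxtr_mulC mulKr. Qed.

(** [S^-1 [S, T] = T S^-1 T^-1] is conjugate to [S^-1], so its trace is [\tr S]; [SL2_tr_mul] does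
    the rest. *)
Lemma tr_mul_commutator : \tr (S * commutator S T) = \tr S * (k - 1).
Proof.
have e : \tr (S^-1 * commutator S T) = \tr S.
  by rewrite /commutator -!mulrA mulKr // mxtr_mulC divrK // SL2_tr_inv.
by rewrite SL2_tr_mul // e mulrBr mulr1.
Qed.

Lemma tr_mul_commutator_mul : \tr (S * commutator S T * T) = \tr (S * T).
Proof. by rewrite /commutator -mulrA divrK // mxtr_mulC divrK. Qed.
End Traces.

Section TracesSwap.
Variable F : fieldType.
Variables S T : 'M[F]_2.
Hypotheses (dS : \det S = 1) (dT : \det T = 1).
Local Notation k := (\tr (commutator S T)).
Let uS := SL2_unit dS.
Let uT := SL2_unit dT.

Lemma tr_commutatorC : \tr (commutator T S) = k.
Proof. by rewrite !tr_commutator // (mxtr_mulC T); ring. Qed.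

Lemma tr_inv_mul_commutator : \tr (S^-1 * commutator T S) = \tr S * (k - 1).
Proof.
have e : \tr (S * commutator T S) = \tr S.
  by rewrite mxtr_mulC /commutator divrK // mxtr_mulC mulKr.
have := SL2_tr_mul (commutator T S) dS.
by rewrite e tr_commutatorC mulrBr mulr1 => {}e; rewrite [X in _ - X]e subKr.
Qed.

Lemma tr_commutator_inv_mulr : \tr (commutator T S * T) = \tr T * (k - 1).
Proof. by rewrite mxtr_mulC tr_mul_commutator // tr_commutatorC. Qed.

(** Two uses of [SL2_tr_mul]: the first passes to [\tr (T S [T, S])], the second splits off [T S]
    and leaves [(T S)^-1 [T, S] = (S T)^-1], of trace [\tr (S T)]. *)
Lemma tr_inv_mul_commutator_mul :
  \tr (S^-1 * commutator T S * T) = (\tr S * \tr T - \tr (S * T)) * (k - 1).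
Proof.
have e1 := SL2_tr_mul (commutator T S * T) dS.
have dTS : \det (T * S) = 1 by rewrite det_mulr dT dS mulr1.
have e2 := SL2_tr_mul (commutator T S) dTS.
have e3 : (T * S)^-1 * commutator T S = S^-1 * T^-1 * (T * S) * (S * T)^-1.
  by rewrite /commutator !invrM // !mulrA.
have e4 : \tr (S^-1 * T^-1 * (T * S) * (S * T)^-1) = \tr (S * T).
  rewrite -[S^-1 * T^-1]invrM // mulVr ?SL2_unit // mul1r.
  by rewrite SL2_tr_inv // det_mulr dT dS mulr1.
have e5 : \tr (S * (commutator T S * T)) = \tr (T * S * commutator T S).
  by rewrite mulrA mxtr_mulC mulrA.
rewrite e5 e2 e3 e4 tr_commutator_inv_mulr tr_commutatorC (mxtr_mulC T S) in e1.
by rewrite -mulrA; apply: (@eq_of_multiple _ _ _ 1 _ _ e1); ring.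
Qed.
End TracesSwap.

(** * Words [E T E^-1 T] and their commutation with [S] *)

Section Sandwich.
Variable F : fieldType.
Variables S T E : 'M[F]_2.
Hypotheses (dT : \det T = 1) (dE : \det E = 1).

(** The value is [(\tr T)^2 - \tr [E, T]], with the commutator trace expanded. *)
Lemma tr_inv_sandwich : \tr (E * T * E^-1 * T) =
  2 - \tr E ^+ 2 - \tr (E * T) ^+ 2 + \tr E * \tr (E * T) * \tr T.
Proof. by rewrite SL2_inv // tr_inv_sandwich_hom dT dE !mulr1. Qed.

(* Pairing S M = M S with T isolates (up to the factor 2 - tr [S, T]) the
   coefficient of S T in M, written in the basis 1, S, T, S T. *)
Lemma sandwich_commute_relation :
  let M := E * T * E^-1 * T in
  \tr (S * M * T) = \tr (M * S * T) ->
  \tr (S * E * T) * (\tr E * \tr T ^+ 2 - \tr (E * T) * \tr T - 2 * \tr E)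
  + \tr (S * E) * (2 * \tr (E * T) - \tr E * \tr T)
  + \tr (S * T) * (\tr E ^+ 2 + \tr (E * T) ^+ 2 - \tr E * \tr (E * T) * \tr T) = 0.
Proof.
move=> M /eqP; rewrite -subr_eq0 => /eqP; rewrite /M SL2_inv //.
by rewrite tr_sandwich_commutator_hom dT !mulr1.
Qed.
End Sandwich.

(** * Traces of the longitudes *)

Definition odd_longitude (R : unitRingType) (S T : R) n :=
  commutator S T ^+ n * T^-1 * (commutator S T ^+ n)^-1 * T.

Definition even_longitude (R : unitRingType) (S T : R) n :=
  let E := S^-1 * commutator T S ^+ n in E * T * E^-1 * T.

Section Longitude.
Variable F : fieldType.
Implicit Types S T : 'M[F]_2.

Lemma tr_lin (u v : F) (A B : 'M[F]_2) :
  \tr ((u%:M + v *: A) * B) = u * \tr B + v * \tr (A * B).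
Proof.
rewrite mulrDl linearD /= (_ : u%:M * B = u *: B); last exact: mul_scalar_mx.
by rewrite -scalerAl !linearZ.
Qed.

Lemma mul_lin (u v : F) (A B : 'M[F]_2) :
  B * (u%:M + v *: A) = u *: B + v *: (B * A).
Proof.
by rewrite mulrDr -scalerAr (_ : B * u%:M = u *: B); last exact: mul_mx_scalar.
Qed.

(** The pair [u], [v] is chosen before [A], so it serves both [[S, T]] and [[T, S]]. The quadratic
    relation says [\det (u + v A) = 1]. *)
Lemma SL2_exp (k : F) n : exists u v : F, u ^+ 2 + u * v * k + v ^+ 2 = 1 /\
  forall A : 'M[F]_2, \det A = 1 -> \tr A = k -> A ^+ n = u%:M + v *: A.
Proof.
elim: n => [|n [u [v [N IH]]]].
  exists 1, 0; split=> [|A _ _]; first by ring.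
  by rewrite scale0r addr0.
(* Coefficients of [A (u + v A)] after substituting [A^2 = k A - 1]. *)
exists (- v), (u + k * v); split=> [|A dA tA]; first by rewrite -N; ring.
rewrite exprS (IH A) // mul_lin cayley_hamilton2 dA tA.
by apply: mx2P; rewrite !mxE /=; ring.
Qed.

Section Traces.
Variables S T : 'M[F]_2.
Hypotheses (dS : \det S = 1) (dT : \det T = 1).
Notation x := (\tr S).
Notation y := (\tr T).
Notation z := (\tr (S * T)).
Notation k := (\tr (commutator S T)).
Let dK := det_commutator dS dT.
Let dK' := det_commutator dT dS.

(** * The longitude for odd [p] *)

Section Odd.
Variables (n : nat) (u v : F).
Hypotheses (N : u ^+ 2 + u * v * k + v ^+ 2 = 1)
  (eE : commutator S T ^+ n = u%:M + v *: commutator S T).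
Notation E := (commutator S T ^+ n).

Let dE : \det E = 1. Proof. by rewrite SL2_det_exp. Qed.
Let e : \tr E = 2 * u + v * k.
Proof. by rewrite eE linearD linearZ /= mxtrace_scalar; ring. Qed.
Let f : \tr (E * T) = y * (u + v).
Proof. by rewrite eE tr_lin tr_commutator_mulr //; ring. Qed.

(** Substituting [T^-1 = y - T] replaces the inner [T^-1] by [T], so that the sandwich lemmas apply
    to both parities. *)
Let odd_longitude_sandwich : odd_longitude S T n = y *: T - E * T * E^-1 * T.
Proof.
rewrite /odd_longitude (SL2_inv dT) mulrBr.
rewrite (_ : E * y%:M = y *: E); last exact: mul_mx_scalar.
by rewrite !mulrBl -!scalerAl divrr ?SL2_unit // mul1r.
Qed.

Lemma tr_odd_longitude :
  \tr (odd_longitude S T n) = 2 + v ^+ 2 * (k - 2) * (k + 2 - y ^+ 2).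
Proof.
rewrite odd_longitude_sandwich linearB linearZ /= tr_inv_sandwich // e f.
by apply: (@eq_of_multiple _ _ _ (4 - y ^+ 2) _ _ N); ring.
Qed.

Lemma odd_longitude_relation :
    S * odd_longitude S T n = odd_longitude S T n * S ->
    k != 2 -> v != 0 ->
  (2 * z - x * y) ^+ 2 * (4 + (k + 2) * (v ^+ 2 * (k - 2))) =
  x ^+ 2 * y ^+ 2 * (v ^+ 2 * (k - 2)) * (k - 2).
Proof.
move=> comm k2 v0.
have g : \tr (S * E) = x * (u + v * (k - 1)).
  by rewrite eE mul_lin linearD !linearZ /= tr_mul_commutator //; ring.
have q : \tr (S * E * T) = z * (u + v).
  rewrite eE mul_lin mulrDl -!scalerAl linearD !linearZ /=.
  by rewrite tr_mul_commutator_mul //; ring.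
have := congr1 (fun A => \tr (A * T)) comm; rewrite odd_longitude_sandwich.
rewrite mulrBr !mulrBl -scalerAr -!scalerAl !linearB /= !linearZ /=.
(* By cyclicity the term [y *: T] contributes [y * \tr (S * T * T)] to both sides; it cancels,
   leaving the relation for [E T E^-1 T]. *)
rewrite [\tr (T * S * T)]mxtr_mulC mulrA [\tr (T * T * S)]mxtr_mulC mulrA.
move/addrI/oppr_inj => /(sandwich_commute_relation dT dE).
rewrite e f g q => rel0.
(* Twice the left side of [rel0] is [v (k - 2)] times the difference of the two sides. *)
have rel : (2 * z - x * y) * (2 * u + v * k) = v * x * y * (k - 2).
  have k20 : v * (k - 2) != 0 by rewrite mulf_neq0 // subr_eq0.
  apply: (mulfI k20); apply: (@eq_of_multiple _ _ _ 2 _ _ rel0).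
  by rewrite (tr_commutator dS dT); ring.
(* Squaring eliminates [u]: by [N], [(2 u + v k)^2 = 4 + (k + 2) v^2 (k - 2)]. *)
transitivity (((2 * z - x * y) * (2 * u + v * k)) ^+ 2); last by rewrite rel; ring.
apply: (@eq_of_multiple _ _ _ (- 4 * (2 * z - x * y) ^+ 2) _ _ N); ring.
Qed.
End Odd.

(** * The longitude for even [p] *)

Section Even.
Variables (n : nat) (u v : F).
Hypotheses (N : u ^+ 2 + u * v * k + v ^+ 2 = 1)
  (eK : commutator T S ^+ n = u%:M + v *: commutator T S).
Notation E := (S^-1 * commutator T S ^+ n).
Notation m := (- (u + v * (k - 1)) ^+ 2).

Let uS : S \is a GRing.unit. Proof. exact: SL2_unit. Qed.
Let dE : \det E = 1.
Proof. by rewrite det_mulr SL2_det_inv // SL2_det_exp // mulr1. Qed.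
Let e : \tr E = x * (u + v * (k - 1)).
Proof.
rewrite eK mul_lin linearD !linearZ /= SL2_tr_inv // tr_inv_mul_commutator //; ring.
Qed.
Let f : \tr (E * T) = (x * y - z) * (u + v * (k - 1)).
Proof.
rewrite eK mul_lin mulrDl -!scalerAl linearD !linearZ /=.
rewrite tr_inv_mul_commutator_mul //.
have -> : \tr (S^-1 * T) = x * y - z by rewrite (SL2_tr_mul T dS) subKr.
ring.
Qed.

Lemma tr_even_longitude :
  \tr (even_longitude S T n) = 2 + m * (k + 2 - y ^+ 2).
Proof.
rewrite tr_inv_sandwich // e f (tr_commutator dS dT); ring.
Qed.

Lemma even_longitude_relation :
    S * even_longitude S T n = even_longitude S T n * S ->
    k != 2 -> m != 0 ->
  (2 * z - x * y) ^+ 2 * (4 + (k + 2) * m) =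
  x ^+ 2 * y ^+ 2 * m * (k - 2).
Proof.
move=> comm k2; rewrite oppr_eq0 sqrf_eq0 => G0.
have g : \tr (S * E) = 2 * u + v * k.
  by rewrite mulVKr // eK linearD linearZ /= mxtrace_scalar tr_commutatorC //; ring.
have q : \tr (S * E * T) = y * (u + v * (k - 1)).
  by rewrite mulVKr // eK tr_lin tr_commutator_inv_mulr //; ring.
have := congr1 (fun A => \tr (A * T)) comm.
move/(sandwich_commute_relation dT dE).
rewrite e f g q => rel0.
(* The left side of [rel0] is [(k - 2) (u + v (k - 1))] times the difference of the two sides. *)
have rel : z * (u + v * k + v) = x * y * v.
  have k20 : (k - 2) * (u + v * (k - 1)) != 0 by rewrite mulf_neq0 // subr_eq0.
  apply: (mulfI k20); apply: (@eq_of_multiple _ _ _ 1 _ _ rel0).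
  by rewrite (tr_commutator dS dT); ring.
(* By [N], [4 + (k + 2) m = (2 - k) (u + v k + v)^2]. *)
transitivity (((2 * z - x * y) * (u + v * k + v)) ^+ 2 * (2 - k)).
  apply: (@eq_of_multiple _ _ _ (- 4 * (2 * z - x * y) ^+ 2) _ _ N); ring.
have -> : (2 * z - x * y) * (u + v * k + v) = - (x * y * (u + v * (k - 1))).
  by apply: (@eq_of_multiple _ _ _ 2 _ _ rel); ring.
ring.
Qed.
End Even.
End Traces.
End Longitude.

(** Here [k] is the trace of [commutator S T] written as a polynomial in [x], [y], [z]; only [m]
    depends on [p] and its parity. *)
Definition trace_relations (F : fieldType) (S T : 'M[F]_2) (lS lT m : F) :=
  let x := \tr S in let y := \tr T in let z := \tr (S * T) in
  let k := x ^+ 2 + y ^+ 2 + z ^+ 2 - x * y * z - 2 in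
  [/\ lS = 2 + m * (k + 2 - y ^+ 2), lT = 2 + m * (k + 2 - x ^+ 2) &
      (2 * z - x * y) ^+ 2 * (4 + (k + 2) * m) = x ^+ 2 * y ^+ 2 * m * (k - 2)].

Lemma odd_trace_relations (F : fieldType) (S T : 'M[F]_2) n :
  \det S = 1 -> \det T = 1 ->
  S * odd_longitude S T n = odd_longitude S T n * S ->
  \tr (odd_longitude S T n) != 2 ->
  exists m, trace_relations S T (\tr (odd_longitude S T n))
                                (\tr (odd_longitude T S n)) m.
Proof.
move=> dS dT comm; set k := \tr (commutator S T).
have [u [v [N pow]]] := SL2_exp k n.
have eST := pow _ (det_commutator dS dT) erefl.
have eTS := pow _ (det_commutator dT dS) (tr_commutatorC dS dT).
have N' : u ^+ 2 + u * v * \tr (commutator T S) + v ^+ 2 = 1.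
  by rewrite (tr_commutatorC dS dT).
rewrite (tr_odd_longitude dS dT N eST) (tr_odd_longitude dT dS N' eTS).
rewrite (tr_commutatorC dS dT) -/k => l2.
have /norP[v0 k2] : ~~ ((v == 0) || (k == 2)).
  apply: contra l2 => /orP[] /eqP ->; apply/eqP; first by rewrite expr0n /= !mul0r addr0.
  by rewrite subrr mulr0 mul0r addr0.
exists (v ^+ 2 * (k - 2)).
rewrite /trace_relations /= -(tr_commutator dS dT); split=> //.
exact: (odd_longitude_relation dS dT N eST).
Qed.

(** The last hypothesis excludes [k = 2]: there [N] reads [(u + v)^2 = 1], so [m = -1] and the trace
    would be [\tr T ^+ 2 - 2]. *)
Lemma even_trace_relations (F : fieldType) (S T : 'M[F]_2) n :
  \det S = 1 -> \det T = 1 ->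
  S * even_longitude S T n = even_longitude S T n * S ->
  \tr (even_longitude S T n) != 2 ->
  \tr (even_longitude S T n) != \tr T ^+ 2 - 2 ->
  exists m, trace_relations S T (\tr (even_longitude S T n))
                                (\tr (even_longitude T S n)) m.
Proof.
move=> dS dT comm; set k := \tr (commutator S T).
have [u [v [N pow]]] := SL2_exp k n.
have eST := pow _ (det_commutator dS dT) erefl.
have eTS := pow _ (det_commutator dT dS) (tr_commutatorC dS dT).
have N' : u ^+ 2 + u * v * \tr (commutator T S) + v ^+ 2 = 1.
  by rewrite (tr_commutatorC dS dT).
rewrite (tr_even_longitude dS dT eTS) (tr_even_longitude dT dS eST).
rewrite (tr_commutatorC dS dT) -/k => l2 ly.
have m0 : - (u + v * (k - 1)) ^+ 2 != 0.
  by apply: contra l2 => /eqP ->; rewrite mul0r addr0.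
have k2 : k != 2.
  apply: contra ly => /eqP k2; rewrite k2 in N *; apply/eqP.
  by apply: (@eq_of_multiple _ _ _ (\tr T ^+ 2 - 4) _ _ N); ring.
exists (- (u + v * (k - 1)) ^+ 2).
rewrite /trace_relations /= -(tr_commutator dS dT); split=> //.
exact: (even_longitude_relation dS dT N eTS).
Qed.

(** The two sides of the rule differ by [m (x^2 - y^2)] times the third relation. The rule then
    makes [x] and [y] vanish together or not at all. *)
Lemma trace_tangent_rule (F : numFieldType) (S T : 'M[F]_2) (lS lT m : F) :
  trace_relations S T lS lT m ->
  lS != 2 -> lS != - 2 -> lT != 2 -> lT != - 2 ->
  [/\ \tr S != 0, \tr T != 0 &
   (lS + 2) * (lT - 2) * (\tr S ^+ 2 * (4 - \tr T ^+ 2)) =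
   (lT + 2) * (lS - 2) * (\tr T ^+ 2 * (4 - \tr S ^+ 2))].
Proof.
rewrite /trace_relations; set x := \tr S; set y := \tr T; set z := \tr (S * T).
move=> /= [eS eT rel] lS2 lSN2 lT2 lTN2.
have rule : (lS + 2) * (lT - 2) * (x ^+ 2 * (4 - y ^+ 2)) =
            (lT + 2) * (lS - 2) * (y ^+ 2 * (4 - x ^+ 2)).
  apply: (@eq_of_multiple _ _ _ (m * (x ^+ 2 - y ^+ 2)) _ _ rel).
  by rewrite eS eT; ring.
have nz2 (a : F) : a != 2 -> a - 2 != 0 by rewrite subr_eq0.
have nzN2 (a : F) : a != - 2 -> a + 2 != 0 by rewrite -{2}[2]opprK subr_eq0.
have x0y0 : x = 0 -> y = 0.
  move=> x0; apply/eqP; apply: contraTT isT => y0; move/eqP: rule.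
  rewrite x0 expr0n /= mul0r mulr0 eq_sym subr0 !mulf_eq0.
  by rewrite (negPf (nzN2 _ lTN2)) (negPf (nz2 _ lS2)) (negPf y0) pnatr_eq0.
have y0x0 : y = 0 -> x = 0.
  move=> y0; apply/eqP; apply: contraTT isT => x0; move/eqP: rule.
  rewrite y0 expr0n /= mul0r mulr0 subr0 !mulf_eq0.
  by rewrite (negPf (nzN2 _ lSN2)) (negPf (nz2 _ lT2)) (negPf x0) pnatr_eq0.
(* If both vanish, then [k + 2 = z^2] and the third relation gives [z = 0] or [m z^2 = -4], that is
   [lS = 2] or [lS = -2]. *)
have xy0 : ~ (x = 0 /\ y = 0).
  case=> x0 y0; have : z ^+ 2 * (4 + z ^+ 2 * m) == 0.
    apply/eqP; have h4 : 4 != 0 :> F by rewrite pnatr_eq0.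
    apply: (mulfI h4); apply: (@eq_of_multiple _ _ _ 1 _ _ rel).
    by rewrite x0 y0; ring.
  rewrite mulf_eq0 => /orP[] /eqP h.
    move/eqP: lS2; apply; apply: (@eq_of_multiple _ _ _ m _ _ h); rewrite eS x0 y0; ring.
  move/eqP: lSN2; apply; apply: (@eq_of_multiple _ _ _ 1 _ _ h); rewrite eS x0 y0; ring.
by split=> //; apply/eqP => h0; apply: xy0; split; auto.
Qed.

(** * Complex hyperbolic functions *)

Lemma cexpD (R : realType) (z w : R[i]) : cexp (z + w) = cexp z * cexp w.
Proof.
case: z w => [a b] [c e]; rewrite /cexp /= expRD cosD sinD.
by apply/eqP; rewrite eq_complex /=; apply/andP; split; apply/eqP; ring.
Qed.

Lemma cexp0 (R : realType) : cexp (0 : R[i]) = 1.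
Proof.
by apply/eqP; rewrite eq_complex /= expR0 cos0 sin0 mulr1 mulr0 !eqxx.
Qed.

Lemma cexpN (R : realType) (z : R[i]) : cexp z * cexp (- z) = 1.
Proof. by rewrite -cexpD subrr cexp0. Qed.

Lemma csinhE (R : realType) (z : R[i]) :
  csinh z = Complex (sinh (complex.Re z) * cos (complex.Im z))
                    (cosh (complex.Re z) * sin (complex.Im z)).
Proof.
case: z => a b; rewrite /csinh /cexp /sinh /cosh /= cosN sinN.
apply: (mulIf (_ : 2 != 0 :> R[i])); first by rewrite pnatr_eq0.
rewrite divfK ?pnatr_eq0 //.
by apply/eqP; rewrite eq_complex /=; apply/andP; split; apply/eqP; field.
Qed.

Lemma ccoshE (R : realType) (z : R[i]) :
  ccosh z = Complex (cosh (complex.Re z) * cos (complex.Im z))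
                    (sinh (complex.Re z) * sin (complex.Im z)).
Proof.
case: z => a b; rewrite /ccosh /cexp /sinh /cosh /= cosN sinN.
apply: (mulIf (_ : 2 != 0 :> R[i])); first by rewrite pnatr_eq0.
rewrite divfK ?pnatr_eq0 //.
by apply/eqP; rewrite eq_complex /=; apply/andP; split; apply/eqP; field.
Qed.

Lemma sinh_gt0 (R : realType) (x : R) : 0 < x -> 0 < sinh x.
Proof. by move=> x0; rewrite divr_gt0 // subr_gt0 ltr_expR gtrN. Qed.

Lemma cosh2_sinh2 (R : realType) (x : R) : cosh x ^+ 2 - sinh x ^+ 2 = 1.
Proof.
by rewrite -(expRxMexpNx_1 x) /cosh /sinh; field.
Qed.

Lemma cosh_gt0 (R : realType) (x : R) : 0 < cosh x.
Proof. by rewrite divr_gt0 // addr_gt0 ?expR_gt0. Qed.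

Lemma Re_mulc (R : realType) (z w : R[i]) :
  complex.Re (z * w) = complex.Re z * complex.Re w - complex.Im z * complex.Im w.
Proof. by case: z w => [a b] [c e]. Qed.

(** For [z = a + i b] the real part is [sinh a cosh a / (sinh^2 a + cos^2 b)]. *)
Lemma Re_ctanh_gt0 (R : realType) (z : R[i]) :
  0 < complex.Re z -> 0 < complex.Re (ctanh z).
Proof.
rewrite /ctanh csinhE ccoshE; case: z => a b /= a0.
have s0 := sinh_gt0 a0; have c0 := cosh_gt0 a.
have n0 : 0 < (cosh a * cos b) ^+ 2 + (sinh a * sin b) ^+ 2.
  have -> : (cosh a * cos b) ^+ 2 + (sinh a * sin b) ^+ 2 = sinh a ^+ 2 + cos b ^+ 2.
    have eC : cosh a ^+ 2 = 1 + sinh a ^+ 2 by rewrite -(cosh2_sinh2 a) subrK.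
    move: eC; generalize (cosh a) (sinh a) => C S eC.
    by rewrite !exprMn eC sin2cos2; ring.
  by rewrite ltr_pwDl ?sqr_ge0 // exprn_gt0.
rewrite (_ : _ - _ = sinh a * cosh a * (cos b ^+ 2 + sin b ^+ 2)
   / ((cosh a * cos b) ^+ 2 + (sinh a * sin b) ^+ 2)); last first.
  by field; rewrite gt_eqF.
by rewrite cos2Dsin2 mulr1 divr_gt0 // mulr_gt0.
Qed.

(** Half-argument formulas. If [ccosh z = 0], both sides are 0 because division by 0 yields 0. *)
Lemma ctanh_sqr (R : realType) (z : R[i]) :
  ctanh z ^+ 2 = (ccosh (z + z) - 1) / (ccosh (z + z) + 1).
Proof.
have e := cexpN z.
have -> : ccosh (z + z) - 1 = 2 * csinh z ^+ 2.
  by rewrite /ccosh /csinh opprD !cexpD -[X in _ - X]e; field.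
have -> : ccosh (z + z) + 1 = 2 * ccosh z ^+ 2.
  by rewrite /ccosh opprD !cexpD -[X in _ + X]e; field.
by rewrite -mulf_div divff ?pnatr_eq0 // mul1r -expr_div_n.
Qed.

(** A real value forces [sin b = 0], hence [cos^2 b = 1], and its square is [cosh^2 a > 1]. This
    keeps the traces of the longitudes out of the real segment from -2 to 2. *)
Lemma ccosh_neq_real (R : realType) (z : R[i]) (c : R) :
  0 < complex.Re z -> c ^+ 2 <= 1 -> ccosh z != Complex c 0.
Proof.
rewrite ccoshE; case: z => a b /= a0 c1; rewrite eq_complex /=.
apply/negP => /andP[/eqP e]; rewrite mulf_eq0 gt_eqF ?sinh_gt0 //= => /eqP b0.
have := cos2Dsin2 b; rewrite b0 expr0n addr0 => cb.
have : cosh a ^+ 2 <= 1.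
  by rewrite -[X in X <= _]mulr1 -{1}cb -(exprMn 2 (cosh a)) e.
have := cosh2_sinh2 a; have : 0 < sinh a ^+ 2 by rewrite exprn_gt0 ?sinh_gt0.
lra.
Qed.

(** * The holonomy representation *)

Lemma expr_conj (R : unitRingType) (U A : R) n : U \is a GRing.unit ->
  (U^-1 * A * U) ^+ n = U^-1 * A ^+ n * U.
Proof.
move=> uU; elim: n => [|n IH]; first by rewrite !expr0 mulr1 mulVr.
by rewrite !exprS IH !mulrA mulrK.
Qed.

Lemma commutator_unit (R : unitRingType) (S T : R) :
  S \is a GRing.unit -> T \is a GRing.unit -> commutator S T \is a GRing.unit.
Proof. by move=> uS uT; rewrite /commutator !unitrMl ?unitrV. Qed.

Lemma commutatorV (R : unitRingType) (S T : R) :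
  S \is a GRing.unit -> T \is a GRing.unit -> (commutator S T)^-1 = commutator T S.
Proof.
move=> uS uT; have uK := commutator_unit uS uT.
by apply: (mulrI uK); rewrite divrr // /commutator !mulrA !(divrK, mulrK) // divrr.
Qed.

(** [[S, T^-1]] is the conjugate of [[S, T]^-1] by [T^-1], and conjugation passes through powers. *)
Lemma odd_longitudeE (R : unitRingType) (S T : R) n :
  S \is a GRing.unit -> T \is a GRing.unit ->
  commutator S T ^+ n * commutator S T^-1 ^+ n = odd_longitude S T n.
Proof.
move=> uS uT; rewrite /odd_longitude.
have -> : commutator S T^-1 = T^-1 * (commutator S T)^-1 * T.
  by rewrite commutatorV // /commutator invrK !mulrA mulVr // mul1r.
by rewrite expr_conj // exprVn !mulrA.
Qed.

(** With [K = [T, S]], [[S^-1, T^-1]] is the conjugate of [K^-1] by [(T S)^-1]. Then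
    [S T (T S)^-1 = K^-1] moves past [K^-n], and [K^-1 T S = S T]. *)
Lemma even_longitudeE (R : unitRingType) (S T : R) n :
  S \is a GRing.unit -> T \is a GRing.unit ->
  S^-1 * commutator T S ^+ n * (T * S * T) * commutator S^-1 T^-1 ^+ n =
  even_longitude S T n.
Proof.
move=> uS uT; rewrite /even_longitude.
set K := commutator T S; have uK : K \is a GRing.unit by exact: commutator_unit.
have uKn : K ^+ n \is a GRing.unit by rewrite unitrX.
have uTS : T * S \is a GRing.unit by rewrite unitrMl.
have -> : commutator S^-1 T^-1 = (T * S)^-1 * K^-1 * (T * S).
  rewrite /K commutatorV // /commutator invrM // !invrK !mulrA.
  by rewrite !divrK.
have -> : (S^-1 * K ^+ n)^-1 = (K ^+ n)^-1 * S by rewrite invrM ?unitrV // invrK.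
rewrite expr_conj // exprVn -!mulrA; congr (_ * (_ * (_ * _))).
have -> : S * (T * ((T * S)^-1 * ((K ^+ n)^-1 * (T * S)))) =
          K^-1 * (K ^+ n)^-1 * (T * S).
  by rewrite /K commutatorV // /commutator invrM // !mulrA.
have -> : K^-1 * (K ^+ n)^-1 = (K ^+ n)^-1 * K^-1.
  by rewrite -invrM // -invrM // -exprS -exprSr.
by rewrite /K commutatorV // /commutator -!mulrA mulKr // mulVr // mulr1.
Qed.

Section Representation.
Variables (R : realType) (p : nat) (h : word -> 'M[R[i]]_2).
Hypothesis rep : is_SL2_rep p h.

Lemma rep_unit w : h w \is a GRing.unit.
Proof. by have [dh _ _] := rep; exact/SL2_unit/dh. Qed.

Lemma rep1 : h Wone = 1.
Proof.
have [_ hM hE] := rep; apply: (mulrI (rep_unit Wone)); rewrite mulr1.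
by rewrite -[LHS]hM; apply: hE; exact: Phi_mul1.
Qed.

Lemma repV w : h (Winv w) = (h w)^-1.
Proof.
have [_ hM hE] := rep; apply: (mulIr (rep_unit w)); rewrite mulVr ?rep_unit //.
by rewrite -rep1 -[LHS]hM; apply: hE; exact: Phi_mulV.
Qed.

Lemma repM w w' : h (Wmul w w') = h w * h w'.
Proof. by have [_ hM _] := rep; exact: hM. Qed.

Lemma repX w n : h (Wpow w n) = h w ^+ n.
Proof. by elim: n => [|n IH] /=; [exact: rep1 | rewrite repM IH exprS]. Qed.

Lemma rep_comm w w' : h (Wcomm w w') = commutator (h w) (h w').
Proof. by rewrite !repM !repV. Qed.

Lemma rep_longitude w w' : h (longitude p w w') =
  if odd p then odd_longitude (h w) (h w') p.+1./2
  else even_longitude (h w) (h w') p./2.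
Proof.
have u1 := rep_unit w; have u2 := rep_unit w'.
rewrite /longitude; case: ifP => _.
  by rewrite repM !repX !rep_comm repV odd_longitudeE.
by rewrite !repM !repX !rep_comm !repV even_longitudeE.
Qed.
End Representation.

Lemma complex_length_tr (R : realType) (L : 'M[R[i]]_2) (g : R[i]) :
  is_complex_length L g ->
  [/\ 0 < complex.Re (ctanh (g / 4)),
      ctanh (g / 4) ^+ 2 = (\tr L + 2) / (\tr L - 2) &
      forall c : R, c ^+ 2 <= 1 -> \tr L != real_complex R (2 * c)].
Proof.
case=> _ g0 e; have n2 : 2 != 0 :> R[i] by rewrite pnatr_eq0.
have g2 : g / 2 = g / 4 + g / 4 by field.
have tr c : \tr L = real_complex R (2 * c) -> ccosh (g / 2) = Complex (- c) 0.
  move=> h; rewrite e h rmorphM /= mulrC rmorph_nat mulKf //.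
  by apply/eqP; rewrite eq_complex /= oppr0 !eqxx.
have ell (c : R) : c ^+ 2 <= 1 -> \tr L != real_complex R (2 * c).
  move=> c1; apply/eqP => /tr.
  have r2 : 0 < complex.Re (g / 2).
    have : g = g / 2 + g / 2 by field.
    move/(congr1 (@complex.Re R)); rewrite raddfD /= => h; lra.
  by apply/eqP; apply: ccosh_neq_real => //; rewrite sqrrN.
have r4 : 0 < complex.Re (g / 4).
  have : g = g / 4 + g / 4 + (g / 4 + g / 4) by field.
  move/(congr1 (@complex.Re R)); rewrite !raddfD /= => h; lra.
split=> //; first exact: Re_ctanh_gt0.
rewrite ctanh_sqr -g2 e.
have t2 : \tr L - 2 != 0.
  by rewrite subr_eq0; have := ell 1; rewrite expr1n lexx mulr1 rmorph_nat => ->.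
by field; rewrite t2 -oppr_eq0 opprD opprK.
Qed.

(** With [x = 2 cos (a / 2)], [tan^2 (a / 2) = (4 - x^2) / x^2]; excluding [pi] keeps the cosines
    nonzero. *)
Lemma tan_ratio_sqr (R : realType) (a b : R) : 0 < a < pi -> 0 < b < pi ->
  let x := 2 * cos (a / 2) in let y := 2 * cos (b / 2) in
  [/\ 0 < 4 - x ^+ 2, 0 < 4 - y ^+ 2, 0 < tan (a / 2) / tan (b / 2) &
    (tan (a / 2) / tan (b / 2)) ^+ 2 =
      (y ^+ 2 * (4 - x ^+ 2)) / (x ^+ 2 * (4 - y ^+ 2))].
Proof.
have half t : 0 < t < pi -> 0 < sin (t / 2) /\ 0 < cos (t / 2).
  move=> /andP[t0 tpi]; have h0 : 0 < t / 2 by rewrite divr_gt0.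
  have hp : t / 2 < pi / 2 by rewrite ltr_pM2r.
  split; first by apply: sin_gt0_pihalf; rewrite h0.
  by apply: cos_gt0_pihalf; rewrite hp andbT (lt_trans _ h0) // oppr_lt0 divr_gt0 ?pi_gt0.
move=> /half[sa ca] /half[sb cb] x y.
have e t : 4 - (2 * cos t) ^+ 2 = 4 * sin t ^+ 2 :> R by rewrite sin2cos2; ring.
have p4 (t : R) : 0 < t -> 0 < 4 * t ^+ 2 by move=> t0; rewrite mulr_gt0 // exprn_gt0.
rewrite /x /y !e; split; [exact: p4 | exact: p4 | by rewrite /tan !divr_gt0 |].
rewrite /tan; field; by rewrite !gt_eqF.
Qed.

Theorem theorem8 (R : realType) (p : nat) (alpha beta : R)
    (d : 'rV[R]_4 -> 'rV[R]_4 -> R)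
    (h : word -> 'M[R[i]]_2)
    (gamma_alpha gamma_beta : R[i])
    (halpha : 0 < alpha <= pi)
    (hbeta : 0 < beta <= pi)
    (hyp : is_hyperbolic_twist_cone_manifold p alpha beta d)
    (hol : is_holonomy_lift p alpha beta d h)
    (len_alpha : is_complex_length (h (longitude p Ws Wt)) gamma_alpha)
    (len_beta : is_complex_length (h (longitude p Wt Ws)) gamma_beta) :
  ctanh (gamma_alpha / 4) / ctanh (gamma_beta / 4)
  = Complex (tan (alpha / 2) / tan (beta / 2)) 0.
Proof.
have [x0 [sigma [tau [dev [_ rep _ trS trT]]]]] := hol.
have [A0 A2 ellS] := complex_length_tr len_alpha.
have [B0 B2 ellT] := complex_length_tr len_beta.
have [deth _ hE] := rep.
have dS := deth Ws; have dT := deth Wt.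
have comm := hE _ _ (Phi_rel_s p); rewrite !(repM rep) in comm.
set lS := \tr (h (longitude p Ws Wt)) in A2 ellS *.
set lT := \tr (h (longitude p Wt Ws)) in B2 ellT *.
have ell2 (l : R[i]) : (forall c : R, c ^+ 2 <= 1 -> l != real_complex R (2 * c)) ->
    l != 2 /\ l != - 2.
  move=> ell; split.
    by have := ell 1; rewrite expr1n lexx mulr1 rmorph_nat => ->.
  by have := ell (-1); rewrite sqrrN expr1n lexx mulrN mulr1 rmorphN rmorph_nat => ->.
have [lS2 lSN2] := ell2 _ ellS; have [lT2 lTN2] := ell2 _ ellT.
have {}trS : \tr (h Ws) = real_complex R (2 * cos (alpha / 2)) := trS.
have {}trT : \tr (h Wt) = real_complex R (2 * cos (beta / 2)) := trT.
(* The right side is [2 cos beta], a real number between -2 and 2. *)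
have lSy : lS != \tr (h Wt) ^+ 2 - 2.
  have := ellS (2 * cos (beta / 2) ^+ 2 - 1).
  have -> : real_complex R (2 * (2 * cos (beta / 2) ^+ 2 - 1)) = \tr (h Wt) ^+ 2 - 2.
    rewrite trT -rmorphXn -(rmorph_nat (real_complex R)) -rmorphB.
    by congr (real_complex R _); ring.
  apply; have := cos2Dsin2 (beta / 2).
  have := sqr_ge0 (cos (beta / 2)); have := sqr_ge0 (sin (beta / 2)).
  set c := _ ^+ 2; set s := _ ^+ 2; nra.
have [m rel] : exists m, trace_relations (h Ws) (h Wt) lS lT m.
  move: comm lS2 lSy; rewrite /lS /lT !(rep_longitude rep).
  case: ifP => _ comm lS2 lSy; first exact: odd_trace_relations.
  exact: even_trace_relations.
have [x_neq0 y_neq0 rule] := trace_tangent_rule rel lS2 lSN2 lT2 lTN2.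
(* A cone angle [pi] would give its meridian trace 0, contradicting [x_neq0] or [y_neq0]. *)
have lt_pi (a : R) : 0 < a <= pi -> real_complex R (2 * cos (a / 2)) != 0 -> 0 < a < pi.
  move=> /andP[-> api] ca /=; rewrite lt_neqAle api andbT.
  apply: contra ca => /eqP ->; by rewrite cos_pihalf mulr0.
rewrite trS in x_neq0; rewrite trT in y_neq0.
have [x4 y4 rho0 rho2] := tan_ratio_sqr (lt_pi _ halpha x_neq0) (lt_pi _ hbeta y_neq0).
set rho := tan _ / tan _ in rho0 rho2 *; rewrite -/(real_complex R rho).
set A := ctanh (gamma_alpha / 4) in A0 A2 *.
set B := ctanh (gamma_beta / 4) in B0 B2 *.
have Bn0 : B != 0 by apply: contraTneq B0 => ->; rewrite ltxx.
have : (A / B) ^+ 2 == (real_complex R rho) ^+ 2.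
  rewrite trS trT in rule.
  have e (x y : R) : real_complex R (x ^+ 2 * (4 - y ^+ 2)) =
      real_complex R x ^+ 2 * (4 - real_complex R y ^+ 2).
    by rewrite rmorphM rmorphB !rmorphXn rmorph_nat.
  rewrite expr_div_n A2 B2 -rmorphXn rho2 fmorph_div /= !e invf_div mulf_div eqr_div; first last.
  - rewrite -e fmorph_eq0 mulf_neq0 // ?(gt_eqF x4) ?(gt_eqF y4) // expf_neq0 //.
    by rewrite -(fmorph_eq0 (real_complex R)).
  - by rewrite mulf_neq0 // ?subr_eq0 // -[2]opprK subr_eq0.
  by rewrite rule mulrC [(lT + 2) * _]mulrC.
rewrite eqf_sqr => /orP[] /eqP // AB; exfalso.
(* The wrong root makes [A] a negative real multiple of [B], yet both have positive real part. *)
have {}AB : A = real_complex R (- rho) * B by rewrite rmorphN -AB divfK.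
by move: A0; rewrite AB Re_mulc mul0r subr0 /= mulNr oppr_gt0 pmulr_rlt0 // ltNge ltW.
Qed.
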